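(* Let $\mathbb D$ be a disgroup whose relation $\le$ is a partial order having suprema of all finite subsets. Suppose $(U',d',\mathscr E')$ and $(U'',d'',\mathscr E'')$ are $\mathbb D$-Urysohn spaces. Then there exists a mapping which takes any surjections $s'\colon\mathbb N\to U'$ and $s''\colon\mathbb N\to U''$ to an isometric isomorphism $U'\to U''$.
   Context: Foundations: the result is asserted constructively (intuitionistic set theory, without excluded middle and without choice principles); in particular it is asserted classically. A disgroup $(X,+,0,\leftrightarrow)$ is a commutative monoid $(X,+,0)$ with a binary operation $\leftrightarrow$ (evaluated before $+$) such that, writing $a\le b$ for $a+a\leftrightarrow b=b$, for all $a,b,x\in X$: $a\leftrightarrow b=b\leftrightarrow a$; $a\leftrightarrow0=a$; $a\leftrightarrow b=0$ iff $a=b$; $(a+x)\leftrightarrow(b+x)=a\leftrightarrow b$; $(a+a)\leftrightarrow(b+b)=a\leftrightarrow b+a\leftrightarrow b$; $a+a\le b+b$ implies $a\le b$; $a\leftrightarrow b\le a\leftrightarrow x+b\leftrightarrow x$. A $\mathbb D$-metric space is a set $X$ with $d\colon X\times X\to\mathbb D$ such that $d(a,b)=d(b,a)$, $d(a,c)\le d(a,b)+d(b,c)$ and $d(a,b)=0\iff a=b$. An isometric isomorphism is a bijective distance-preserving map. A $\mathbb D$-Urysohn space is a triple $(U',d',\mathscr E')$ where $(U',d')$ is a $\mathbb D$-metric space and $\mathscr E'\colon\mathscr P'\to U'$ is a map, where $\mathscr P'$ is the set of finite sequences $(x_i,\chi_i)_{i<l}$ ($l\in\mathbb N$) of elements of $U'\times\mathbb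 D$ with $d'(x_i,x_j)\leftrightarrow\chi_i\le\chi_j$ for all $i,j<l$, such that $d'\big(\mathscr E'((x_i,\chi_i)_{i<l}),x_k\big)=\chi_k$ for all $(x_i,\chi_i)_{i<l}\in\mathscr P'$ and all $k<l$. *)

(* Defs.v *)
From Stdlib Require Import List Relations FinFun.

Set Implicit Arguments.

(* Everything is stated over bare types with Leibniz equality: equality on a
   disgroup or on a metric space is not assumed to be decidable. *)

Declare Scope disgroup_scope.
Delimit Scope disgroup_scope with dis.

Record predisgroup : Type := Predisgroup {
  carrier :> Type;
  add : carrier -> carrier -> carrier;
  zero : carrier;
  dis : carrier -> carrier -> carrier
}.

Arguments zero {p}.

Bind Scope disgroup_scope with carrier.

(* [<~>] binds tighter than [+]. *)
Notation "a <~> b" := (dis _ a b)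
  (at level 40, left associativity) : disgroup_scope.
Notation "a + b" := (add _ a b) : disgroup_scope.
Notation "0" := zero : disgroup_scope.

Local Open Scope disgroup_scope.

Definition le (X : predisgroup) (a b : X) : Prop := a + a <~> b = b.

Notation "a <= b" := (le _ a b) : disgroup_scope.

Record is_disgroup (X : predisgroup) : Prop := IsDisgroup {
  addA : forall a b c : X, a + (b + c) = (a + b) + c;
  addC : forall a b : X, a + b = b + a;
  add0 : forall a : X, 0 + a = a;
  disC : forall a b : X, a <~> b = b <~> a;
  dis0 : forall a : X, a <~> 0 = a;
  dis_eq0 : forall a b : X, a <~> b = 0 <-> a = b;
  dis_translate : forall a b x : X, (a + x) <~> (b + x) = a <~> b;
  dis_double : forall a b : X, (a + a) <~> (b + b) = a <~> b + a <~> b;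
  le_halve : forall a b : X, a + a <= b + b -> a <= b;
  dis_triangle : forall a b x : X, a <~> b <= a <~> x + b <~> x
}.

Record disgroup : Type := Disgroup {
  disgroup_pre :> predisgroup;
  disgroupP : is_disgroup disgroup_pre
}.

Definition is_supremum (X : predisgroup) (A : X -> Prop) (u : X) : Prop :=
  (forall a, A a -> a <= u) /\
  (forall v, (forall a, A a -> a <= v) -> u <= v).

(* A finite subset is one listed by a finite sequence, possibly empty and
   possibly with repetitions. *)
Definition has_finite_suprema (X : predisgroup) : Prop :=
  forall l : list X, exists u : X, is_supremum X (fun a => In a l) u.

Record metric_space (D : disgroup) : Type := MetricSpace {
  point :> Type;
  dist : point -> point -> D;
  dist_sym : forall a b, dist a b = dist b a;
  dist_triangle : forall a b c, dist a c <= dist a b + dist b c;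
  dist_eq0 : forall a b, dist a b = 0 <-> a = b
}.

Definition admissible (D : disgroup) (U : metric_space D)
    (s : list (U * D)) : Prop :=
  forall i j x chi y psi,
    nth_error s i = Some (x, chi) -> nth_error s j = Some (y, psi) ->
    dist U x y <~> chi <= psi.

Record urysohn_space (D : disgroup) : Type := UrysohnSpace {
  urysohn_metric :> metric_space D;
  extend : {s : list (urysohn_metric * D) | admissible urysohn_metric s} ->
           urysohn_metric;
  extendP : forall s k x chi,
    nth_error (proj1_sig s) k = Some (x, chi) ->
    dist urysohn_metric (extend s) x = chi
}.

Definition isometric_isomorphism (D : disgroup) (U V : metric_space D)
    (f : U -> V) : Prop :=
  Bijective f /\ (forall x y : U, dist V (f x) (f y) = dist U x y).

(* Main.v *)
Require Import Defs.
From Stdlib Require Import List Relations FinFun PeanoNat Description.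
Import ListNotations.

(** A back-and-forth argument, in which the operations [extend] of the two
    spaces replace every choice.

    The algebraic core is [dis_le_of_le_add]: in a disgroup with binary suprema,
    [p <= q + r] and [q <= p + r] imply [p <~> q <= r].  The order is the
    algebraic one ([le_iff_add]), so the supremum of [p] and [q] can be written
    both as [p + a] and as [q + b].  Leastness makes [a] and [b] disjoint, and
    the supremum of two disjoint elements is their sum; since [a] and [b] are
    both below [r], so is [a + b], which in turn dominates
    [p <~> q = a <~> b].

    Applied to the two triangle inequalities with third side [dist x_i x_j], this
    is the reverse triangle inequality.  It says that if [x_i |-> y_i] is a finite
    partial isometry and [x] is any point, then the prescription of the distances
    [dist x_i x] to the points [y_i] is admissible; so [extend] yields an image
    for [x] ([extension_point]).  Should [x] already be some [x_i], the prescribed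
    distance there is [0], which forces the image to be [y_i]; hence no decision
    whether [x] is new is ever required.

    Alternating between the two enumerations gives an increasing sequence of
    finite partial isometries, a function of the enumerations.  The union of their
    graphs preserves distances, hence is single-valued in both directions, and it
    meets every point of both spaces.  Such a relation is the graph of an isometric
    isomorphism; the passage from the graph to the function uses unique choice
    only. *)

Local Open Scope disgroup_scope.

(** * The order of a disgroup and the distance between two elements *)

Section DisgroupOrder.

Variable D : disgroup.
Implicit Types a b c p q r x : D.

Let addA := addA (disgroupP D).
Let addC := addC (disgroupP D).
Let add0 := add0 (disgroupP D).

Lemma addr0 a : a + 0 = a.
Proof. rewrite addC; apply add0. Qed.

(** Translation invariance of [<~>], which vanishes exactly on equal elements,
    makes the monoid cancellative. *)
Lemma add_cancel_r a b x : a + x = b + x -> a = b.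
Proof.
intros e; apply (dis_eq0 (disgroupP D)).
rewrite <- (dis_translate (disgroupP D) a b x).
now apply (dis_eq0 (disgroupP D)).
Qed.

Lemma add_cancel_l a b x : x + a = x + b -> a = b.
Proof. rewrite !(addC x); apply add_cancel_r. Qed.

Lemma dis_add_r a c : a <~> (a + c) = c.
Proof.
rewrite <- (add0 a) at 1; rewrite (addC a c), (dis_translate (disgroupP D)).
rewrite (disC (disgroupP D)); apply (dis0 (disgroupP D)).
Qed.

Lemma le_add_r a c : a <= a + c.
Proof. unfold le; now rewrite dis_add_r. Qed.

Lemma le_iff_add a b : a <= b <-> exists c, b = a + c.
Proof.
split.
- intros h; exists (a <~> b); now symmetry.
- intros [c ->]; apply le_add_r.
Qed.

Lemma le_cancel_l a b x : x + a <= x + b -> a <= b.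
Proof.
rewrite !le_iff_add; intros [c e]; exists c.
apply (add_cancel_l _ _ x); now rewrite addA.
Qed.

Lemma dis_le_add a b : a <~> b <= a + b.
Proof.
pose proof (dis_triangle (disgroupP D) a b 0) as h.
now rewrite !(dis0 (disgroupP D)) in h.
Qed.

Hypothesis le_order : order D (le D).

Lemma le_antisym a b : a <= b -> b <= a -> a = b.
Proof. apply (ord_antisym _ _ le_order). Qed.

Lemma le_trans a b c : a <= b -> b <= c -> a <= c.
Proof. apply (ord_trans _ _ le_order). Qed.

Lemma add_le_self a c : a + c <= a -> c = 0.
Proof.
intros h; apply (add_cancel_l _ _ a).
rewrite addr0; apply le_antisym; [exact h | apply le_add_r].
Qed.

Lemma is_supremum_pair p q u :
  is_supremum D (fun x => In x [p; q]) u ->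
  p <= u /\ q <= u /\ (forall v, p <= v -> q <= v -> u <= v).
Proof.
intros [ub lub]; split; [|split].
- apply ub; now left.
- apply ub; right; now left.
- intros v pv qv; apply lub; now intros x [<- | [<- | []]].
Qed.

Definition disjoint a b : Prop := forall c, c <= a -> c <= b -> c = 0.

(** A common part [c] of the two complements could be subtracted from the
    least upper bound. *)
Lemma sup_complements_disjoint p q a b :
  p + a = q + b ->
  (forall v, p <= v -> q <= v -> p + a <= v) ->
  disjoint a b.
Proof.
intros e lub c ca cb.
apply le_iff_add in ca as [a' ->]; apply le_iff_add in cb as [b' ->].
apply (add_le_self (p + a')).
assert (e' : p + a' = q + b').
{ apply (add_cancel_r _ _ c).
  now rewrite <- !addA, (addC a' c), (addC b' c). }
rewrite <- addA, (addC a' c).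
apply lub; [apply le_add_r | rewrite e'; apply le_add_r].
Qed.

Hypothesis le_sup : has_finite_suprema D.

(** Below [a + b] the supremum of [a] and [b] leaves a remainder which is a
    common part of [a] and [b]. *)
Lemma disjoint_add_le a b r : disjoint a b -> a <= r -> b <= r -> a + b <= r.
Proof.
intros dis_ab ar br.
destruct (le_sup [a; b]) as [v sup_v].
apply is_supremum_pair in sup_v as (av & bv & lub).
assert (vab : v <= a + b).
{ apply lub; [|rewrite addC]; apply le_add_r. }
apply le_iff_add in vab as [w ew].
apply le_iff_add in av as [a1 ea]; apply le_iff_add in bv as [b1 eb].
assert (w0 : w = 0).
{ apply dis_ab; apply le_iff_add.
  - exists b1; apply (add_cancel_l _ _ b).
    now rewrite (addC b a), ew, eb, (addC w), addA.
  - exists a1; apply (add_cancel_l _ _ a).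
    now rewrite ew, ea, (addC w), addA. }
rewrite ew, w0, addr0; now apply lub.
Qed.

(** The element [p <~> q] is an absolute difference: it lies below every
    [r] which bounds both one-sided differences. *)
Lemma dis_le_of_le_add p q r : p <= q + r -> q <= p + r -> p <~> q <= r.
Proof.
intros hp hq.
destruct (le_sup [p; q]) as [u sup_u].
apply is_supremum_pair in sup_u as (pu & qu & lub).
apply le_iff_add in pu as [a ea]; apply le_iff_add in qu as [b eb].
assert (e : p + a = q + b) by congruence.
assert (ar : a <= r).
{ apply (le_cancel_l _ _ p); rewrite <- ea; apply lub; auto using le_add_r. }
assert (br : b <= r).
{ apply (le_cancel_l _ _ q); rewrite <- eb; apply lub; auto using le_add_r. }
(* Adding [a + b] to both sides turns [p] and [q] into [u + b] and [u + a]. *)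
assert (dis_pq : p <~> q = b <~> a).
{ rewrite <- (dis_translate (disgroupP D) p q (a + b)).
  rewrite (addC a b) at 2; rewrite !addA, <- ea, <- eb, !(addC u).
  apply (dis_translate (disgroupP D)). }
rewrite dis_pq; apply le_trans with (b + a); [apply dis_le_add|].
rewrite addC; apply disjoint_add_le; auto.
apply sup_complements_disjoint with p q; [exact e | now rewrite <- ea].
Qed.

Lemma reverse_triangle (U : metric_space D) (x y z : U) :
  dist U x y <~> dist U x z <= dist U y z.
Proof.
apply dis_le_of_le_add; [rewrite (dist_sym U y z)|]; apply dist_triangle.
Qed.

End DisgroupOrder.

(** * Relations which preserve distances *)

Section IsometricRelations.

Variable D : disgroup.

Definition preserves_dist (U V : metric_space D) (R : U -> V -> Prop) : Prop :=
  forall x y x' y', R x y -> R x' y' -> dist U x x' = dist V y y'.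

Lemma preserves_dist_inv (U V : metric_space D) (R : U -> V -> Prop) :
  preserves_dist U V R -> preserves_dist V U (fun y x => R x y).
Proof. intros iso y x y' x' h h'; symmetry; exact (iso _ _ _ _ h h'). Qed.

Lemma preserves_dist_functional (U V : metric_space D) (R : U -> V -> Prop) :
  preserves_dist U V R -> forall x y y', R x y -> R x y' -> y = y'.
Proof.
intros iso x y y' h h'; apply (dist_eq0 V).
rewrite <- (iso _ _ _ _ h h'); now apply (dist_eq0 U).
Qed.

Lemma function_of_graph (U V : metric_space D) (R : U -> V -> Prop) :
  preserves_dist U V R -> (forall x, exists y, R x y) ->
  {f : U -> V | forall x, R x (f x)}.
Proof.
intros iso total.
assert (unique_image : forall x, exists! y, R x y).
{ intros x; destruct (total x) as [y h]; exists y; split; [exact h|].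
  intros y' h'; exact (preserves_dist_functional _ _ _ iso _ _ _ h h'). }
exists (fun x => proj1_sig (constructive_definite_description _ (unique_image x))).
intros x; apply proj2_sig.
Qed.

Lemma isometric_isomorphism_of_graph (U V : metric_space D)
    (R : U -> V -> Prop) :
  preserves_dist U V R ->
  (forall x, exists y, R x y) -> (forall y, exists x, R x y) ->
  {f : U -> V | isometric_isomorphism U V f}.
Proof.
intros iso total_l total_r.
pose proof (preserves_dist_inv _ _ _ iso) as iso'.
destruct (function_of_graph _ _ _ iso total_l) as [f Rf].
destruct (function_of_graph _ _ _ iso' total_r) as [g Rg].
exists f; split.
- exists g; split.
  + intros x; exact (preserves_dist_functional _ _ _ iso' _ _ _ (Rg _) (Rf _)).
  + intros y; exact (preserves_dist_functional _ _ _ iso _ _ _ (Rf _) (Rg _)).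
- intros x y; symmetry; exact (iso _ _ _ _ (Rf x) (Rf y)).
Qed.

End IsometricRelations.

Arguments preserves_dist {D} U V R.
Arguments preserves_dist_inv {D} U V R.

(** * One-point extension of finite partial isometries *)

Section Extension.

Variable D : disgroup.
Hypothesis le_order : order D (le D).
Hypothesis le_sup : has_finite_suprema D.

(** Pairs may repeat: a point which already has an image may be added again. *)
Definition partial_isometry (U V : metric_space D) : Type :=
  {l : list (U * V) | preserves_dist U V (fun x y => In (x, y) l)}.

Definition empty_isometry (U V : metric_space D) : partial_isometry U V.
Proof. now exists []; intros x y x' y' []. Defined.

Definition graph (U V : metric_space D) (p : partial_isometry U V)
    (x : U) (y : V) : Prop := In (x, y) (proj1_sig p).

Definition swap (U V : metric_space D) (p : partial_isometry U V) :
  {q : partial_isometry V U | forall x y, graph V U q y x <-> graph U V p x y}.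
Proof.
destruct p as [l iso].
assert (in_swap : forall x y,
  In (y, x) (map (fun xy => (snd xy, fst xy)) l) <-> In (x, y) l).
{ intros x y; rewrite in_map_iff; split.
  - intros ([x' y'] & e & h); now injection e as -> ->.
  - intros h; now exists (x, y). }
unshelve eexists.
- exists (map (fun xy => (snd xy, fst xy)) l).
  intros y x y' x'; rewrite !in_swap; apply (preserves_dist_inv _ _ _ iso).
- exact in_swap.
Defined.

(** The image of a new point is determined by the operation [extend], so it is
    obtained as data and not merely known to exist. *)
Definition extension_point (U : metric_space D) (V : urysohn_space D)
    (p : partial_isometry U V) (x : U) :
  {y : V | forall x' y', graph U V p x' y' -> dist U x x' = dist V y y'}.
Proof.
destruct p as [l iso]; unfold graph; simpl.
set (s := map (fun xy => (snd xy, dist U (fst xy) x)) l : list (V * D)).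
assert (adm : admissible V s).
{ intros i j y chi y' psi hi hj.
  apply nth_error_In, in_map_iff in hi as ([x1 y1] & e1 & h1).
  apply nth_error_In, in_map_iff in hj as ([x2 y2] & e2 & h2).
  simpl in e1, e2; injection e1 as <- <-; injection e2 as <- <-.
  rewrite <- (iso _ _ _ _ h1 h2); now apply reverse_triangle. }
exists (extend V (exist _ s adm)); intros x' y' h.
assert (hs : In (y', dist U x' x) s) by (apply in_map_iff; now exists (x', y')).
apply In_nth_error in hs as [k hk].
rewrite (dist_sym U); symmetry; exact (extendP V (exist _ s adm) k hk).
Defined.

Definition extend_domain (U : metric_space D) (V : urysohn_space D)
    (p : partial_isometry U V) (x : U) :
  {q : partial_isometry U V |
    (forall x' y', graph U V p x' y' -> graph U V q x' y') /\
    exists y, graph U V q x y}.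
Proof.
destruct (extension_point U V p x) as [y dist_y].
destruct p as [l iso]; unfold graph in *; simpl in *.
unshelve eexists.
- exists ((x, y) :: l).
  intros x1 y1 x2 y2 [e1 | h1] [e2 | h2];
    try (injection e1 as <- <-); try (injection e2 as <- <-).
  + transitivity (zero : D); [|symmetry]; now apply dist_eq0.
  + now apply dist_y.
  + rewrite (dist_sym U), (dist_sym V); now apply dist_y.
  + now apply iso.
- simpl; split; [auto | exists y; now left].
Defined.

Definition extend_both (U V : urysohn_space D)
    (p : partial_isometry U V) (x : U) (y : V) :
  {q : partial_isometry U V |
    (forall x' y', graph U V p x' y' -> graph U V q x' y') /\
    (exists y', graph U V q x y') /\ (exists x', graph U V q x' y)}.
Proof.
destruct (extend_domain U V p x) as [p1 [sub1 image_x]].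
destruct (swap U V p1) as [p2 eq2].
destruct (extend_domain V U p2 y) as [p3 [sub3 image_y]].
destruct (swap V U p3) as [q eqq].
assert (sub : forall x' y', graph U V p1 x' y' -> graph U V q x' y').
{ intros x' y' h; now apply eqq, sub3, eq2. }
exists q; split; [auto | split].
- destruct image_x as [y1 h1]; exists y1; auto.
- destruct image_y as [x3 h3]; exists x3; now apply eqq.
Defined.

(** * The back-and-forth sequence *)

Variables U V : urysohn_space D.
Variables (s : nat -> U) (t : nat -> V).

Fixpoint approximation (n : nat) : partial_isometry U V :=
  match n with
  | O => empty_isometry U V
  | S m => proj1_sig (extend_both U V (approximation m) (s m) (t m))
  end.

Lemma approximation_incl m n x y :
  Nat.le m n ->
  graph U V (approximation m) x y -> graph U V (approximation n) x y.
Proof.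
induction 1 as [|n _ IH]; [auto | intros h].
exact (proj1 (proj2_sig (extend_both U V (approximation n) (s n) (t n)))
  _ _ (IH h)).
Qed.

Definition limit_graph (x : U) (y : V) : Prop :=
  exists n, graph U V (approximation n) x y.

Lemma limit_graph_preserves_dist : preserves_dist U V limit_graph.
Proof.
intros x y x' y' [m h] [n h'].
apply (proj2_sig (approximation (Nat.max m n))).
- exact (approximation_incl _ _ _ _ (Nat.le_max_l m n) h).
- exact (approximation_incl _ _ _ _ (Nat.le_max_r m n) h').
Qed.

Lemma limit_graph_total_l : Surjective s -> forall x, exists y, limit_graph x y.
Proof.
intros surj x; destruct (surj x) as [n <-].
destruct (proj2_sig (extend_both U V (approximation n) (s n) (t n)))
  as [_ [[y h] _]].
exists y, (S n); exact h.
Qed.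

Lemma limit_graph_total_r : Surjective t -> forall y, exists x, limit_graph x y.
Proof.
intros surj y; destruct (surj y) as [n <-].
destruct (proj2_sig (extend_both U V (approximation n) (s n) (t n)))
  as [_ [_ [x h]]].
exists x, (S n); exact h.
Qed.

End Extension.

Theorem theorem3p13 (D : disgroup)
  (le_order : order D (le D))
  (le_sup : has_finite_suprema D)
  (U' U'' : urysohn_space D) :
  exists F : {s' : nat -> U' | Surjective s'} ->
             {s'' : nat -> U'' | Surjective s''} -> (U' -> U''),
    forall (s' : {s' : nat -> U' | Surjective s'})
           (s'' : {s'' : nat -> U'' | Surjective s''}),
      isometric_isomorphism U' U'' (F s' s'').
Proof.
assert (iso : forall (s' : {s' : nat -> U' | Surjective s'})
                     (s'' : {s'' : nat -> U'' | Surjective s''}),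
  {f : U' -> U'' | isometric_isomorphism U' U'' f}).
{ intros [s' surj'] [s'' surj''].
  apply isometric_isomorphism_of_graph
    with (limit_graph D le_order le_sup U' U'' s' s'').
  - apply limit_graph_preserves_dist.
  - now apply limit_graph_total_l.
  - now apply limit_graph_total_r. }
exists (fun s' s'' => proj1_sig (iso s' s'')).
intros s' s''; apply proj2_sig.
Qed.
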